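(* Let $\mathcal{P}$ be the set of all primitive Pythagorean triples $(x,y,a)$ with $x$ odd and $y$ even. Define a relation $\prec$ on $\mathcal{P}$ by comparing the parameters $(S,t)$ lexicographically: for $P,P'\in\mathcal{P}$ with parameters $(S,t)$ and $(S',t')$ respectively, $P\prec P'$ if and only if $S<S'$, or $S=S'$ and $t<t'$. Then $\prec$ is a (strict) total order on $\mathcal{P}$; that is, the variables $S,t$ set an order on the set of primitive Pythagorean triples.
   Context: A primitive Pythagorean triple is a triple $(x,y,a)$ of positive integers with $x^2+y^2=a^2$ and $\gcd(x,y,a)=1$; $x$ denotes the odd leg and $y$ the even leg. The parameters of such a triple are the positive integers $S,t,l$ with $S=2tl$, $\gcd(t,l)=1$, $l$ odd, and $x=S+l^2$, $y=S+2t^2$, $a=S+l^2+2t^2$ (equivalently $S=x+y-a$, $2t^2=a-x$, $l^2=a-y$). *)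

(* Defs.v *)
From Corelib Require Import RelationClasses.
From mathcomp Require Import all_boot.

Set Implicit Arguments.
Unset Strict Implicit.
Unset Printing Implicit Defensive.

Definition primitive_pythagorean (x y a : nat) : bool :=
  [&& 0 < x, 0 < y, 0 < a, x ^ 2 + y ^ 2 == a ^ 2 & gcdn (gcdn x y) a == 1].

(* The predicate is boolean, so equality of elements of [PPT] is equality of
   the underlying triples ((x, y), a). *)
Definition PPT : Type :=
  {p : nat * nat * nat |
    [&& primitive_pythagorean p.1.1 p.1.2 p.2, odd p.1.1 & ~~ odd p.1.2]}.

Definition odd_leg (P : PPT) : nat := (val P).1.1.
Definition even_leg (P : PPT) : nat := (val P).1.2.
Definition hypotenuse (P : PPT) : nat := (val P).2.

Definition is_parameters (P : PPT) (S t l : nat) : Prop :=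
  [/\ [/\ 0 < S, 0 < t & 0 < l],
      [/\ S = 2 * t * l, coprime t l & odd l] &
      [/\ odd_leg P = S + l ^ 2,
          even_leg P = S + 2 * t ^ 2 &
          hypotenuse P = S + l ^ 2 + 2 * t ^ 2]].

(* A triple without parameters would be incomparable to every triple, so
   totality of [prec] includes the existence of the parameters. *)
Definition prec (P P' : PPT) : Prop :=
  exists S t l S' t' l' : nat,
    [/\ is_parameters P S t l, is_parameters P' S' t' l' &
        S < S' \/ (S = S' /\ t < t')].

(* Main.v *)
Require Import Defs.
From Corelib Require Import RelationClasses.
From mathcomp Require Import all_boot.
From mathcomp Require Import zify.

Set Implicit Arguments.
Unset Strict Implicit.
Unset Printing Implicit Defensive.

(** The parameters of a triple are determined by it, so [prec] is the pullback
    of the lexicographic order on pairs [(S, t)], and [l = S / 2t] recovers the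
    triple from the pair.  For their existence, [(a - y)(a + y) = x ^ 2] and
    [(a - x)/2 * (a + x)/2 = (y / 2) ^ 2] are coprime factorizations of
    squares, hence [a - y = l ^ 2] and [a - x = 2 t ^ 2]; then
    [S ^ 2 = 2 (a - x)(a - y) = (2 t l) ^ 2] for [S = x + y - a]. *)

(** Expanded, [gcdn m k ^ 2] is the gcd of [m * m], [m * k], [k * m] and [k * k = m * n]. Factoring
    out [m] leaves the gcd of [m], [k] and [n], which is 1. *)
Lemma coprime_mul_eq_sqr (m n k : nat) :
  coprime m n -> m * n = k ^ 2 -> m = gcdn m k ^ 2.
Proof.
move=> /eqP co_mn mn_k.
rewrite -mulnn {1}muln_gcdl !muln_gcdr mulnn [k * k]mulnn -mn_k.
rewrite [k * m]mulnC -mulnn -!muln_gcdr.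
by rewrite -gcdnA [gcdn k (gcdn k n)]gcdnA gcdnn gcdnCA co_mn gcdn1 muln1.
Qed.

(** The square of [gcdn y a] divides [a ^ 2] and [y ^ 2], hence [x ^ 2]; so [gcdn y a] divides [x]
    as well. *)
Lemma coprime_leg_hypotenuse (x y a : nat) :
  x ^ 2 + y ^ 2 = a ^ 2 -> gcdn (gcdn x y) a = 1 -> coprime y a.
Proof.
move=> eq_sq gcd1; rewrite /coprime -dvdn1 -gcd1 !dvdn_gcd dvdn_gcdl dvdn_gcdr.
rewrite !andbT -(@dvdn_pexp2r _ _ 2) //.
rewrite -(dvdn_addl _ (dvdn_exp2r 2 (dvdn_gcdl y a))) eq_sq.
exact/dvdn_exp2r/dvdn_gcdr.
Qed.

Lemma odd_leg_factor_sqr (x y a : nat) :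
  x ^ 2 + y ^ 2 = a ^ 2 -> coprime y a -> odd x -> ~~ odd y ->
  exists l, a = y + l ^ 2.
Proof.
move=> eq_sq co_ya odd_x even_y.
have le_ya : y <= a by rewrite -leq_sqr -eq_sq leq_addl.
move: eq_sq co_ya; rewrite -(subnKC le_ya); move: (a - y) => u eq_sq co_yu.
have odd_u : odd u.
  by have := congr1 odd eq_sq; rewrite !(oddD, oddX) odd_x (negbTE even_y).
exists (gcdn u x); congr (_ + _).
(* The cofactor is [a + y], since [a = y + u]. Its gcd with [u] is that of [u] and [2 * y], where
   [u] is odd and coprime to [y]. *)
apply: (@coprime_mul_eq_sqr _ (u + 2 * y)); last by nia.
rewrite /coprime gcdnDl -/(coprime _ _) coprimeMr coprimen2 odd_u /=.
by move: co_yu; rewrite /coprime gcdnDl gcdnC.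
Qed.

Lemma even_leg_factor_sqr (x y a : nat) :
  x ^ 2 + y ^ 2 = a ^ 2 -> coprime x a -> odd x -> ~~ odd y ->
  exists t, a = x + 2 * t ^ 2.
Proof.
move=> eq_sq co_xa odd_x even_y.
have le_xa : x <= a by rewrite -leq_sqr -eq_sq leq_addr.
move: eq_sq co_xa; rewrite -(subnKC le_xa); move: (a - x) => u eq_sq co_xu.
have even_u : ~~ odd u.
  have := congr1 odd eq_sq; rewrite !(oddD, oddX) odd_x (negbTE even_y) /=.
  by case: (odd u).
(* Both [a - x] and [a + x] are even, so coprimality needs halving: with [u = 2 * v] and
   [y = 2 * w], the equation becomes [v * (v + x) = w ^ 2]. *)
move: eq_sq co_xu; rewrite -[u](even_halfK even_u) -[y](even_halfK even_y).
rewrite -!mul2n; move: u./2 y./2 => v w eq_sq co_xv.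
exists (gcdn v w); congr (_ + 2 * _).
apply: (@coprime_mul_eq_sqr _ (v + x)); last by nia.
move: co_xv; rewrite /coprime !gcdnDl -!/(coprime _ _) coprimeMr coprime_sym.
by case/andP=> _; rewrite coprime_sym.
Qed.

Lemma parameters_exist (P : PPT) : exists S t l, is_parameters P S t l.
Proof.
rewrite /is_parameters /odd_leg /even_leg /hypotenuse.
case: P => [[[x y] a] /= /and3P[/and5P[x_gt0 y_gt0 a_gt0 /eqP eq_sq /eqP gcd1]]].
move=> odd_x even_y.
have co_ya := coprime_leg_hypotenuse eq_sq gcd1.
have co_xa : coprime x a.
  by apply: (@coprime_leg_hypotenuse y); rewrite 1?addnC // [gcdn y x]gcdnC.
have [l a_l] := odd_leg_factor_sqr eq_sq co_ya odd_x even_y.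
have [t a_t] := even_leg_factor_sqr eq_sq co_xa odd_x even_y.
(* [(x + y) ^ 2] exceeds [a ^ 2] by [2 * x * y > 0]; this makes [S = x + y - a] positive. *)
have lt_a : a < x + y by nia.
have [S S_def] : exists S, x + y = a + S by exists (x + y - a); lia.
have x_S : x = S + l ^ 2 by lia.
have y_S : y = S + 2 * t ^ 2 by lia.
have S_tl : S = 2 * t * l.
  by apply/eqP; rewrite -(@eqn_exp2r _ _ 2) //; apply/eqP; nia.
have a_S : a = S + l ^ 2 + 2 * t ^ 2 by lia.
have S_gt0 : 0 < S by lia.
have /andP[t_gt0 l_gt0] : (0 < t) && (0 < l).
  by move: S_gt0; rewrite S_tl !muln_gt0.
exists S, t, l; split; split=> //.
(* A common divisor of [t] and [l] divides [S], [l ^ 2] and [2 * t ^ 2], hence all of [x], [y],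
   [a]. *)
- rewrite /coprime -dvdn1 -gcd1 !dvdn_gcd.
  have dvd_l := dvdn_gcdr t l.
  have dvd_t := dvdn_gcdl t l.
  have dvd_S : gcdn t l %| S by rewrite S_tl dvdn_mull.
  have dvd_l2 : gcdn t l %| l ^ 2 by rewrite -mulnn dvdn_mull.
  have dvd_t2 : gcdn t l %| 2 * t ^ 2 by rewrite -mulnn !dvdn_mull.
  rewrite a_S x_S y_S !(dvdn_addl _ dvd_t2).
  by rewrite !(dvdn_addr _ dvd_S) dvd_l2 dvd_S.
- by move: odd_x; rewrite x_S oddD oddX S_tl !oddM.
Qed.

(** The triple gives back [S = x + y - a] and [2 * t ^ 2 = a - x]. *)
Lemma parameters_unique (P : PPT) (S t l S' t' l' : nat) :
  is_parameters P S t l -> is_parameters P S' t' l' -> S = S' /\ t = t'.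
Proof.
move=> [_ _ [eq_x eq_y eq_a]] [_ _ [eq_x' eq_y' eq_a']].
have eq_S : S = S' by lia.
split=> //; apply/eqP; rewrite -(@eqn_exp2r _ _ 2) //; apply/eqP; lia.
Qed.

Lemma parameters_inj (P P' : PPT) (S t l l' : nat) :
  is_parameters P S t l -> is_parameters P' S t l' -> P = P'.
Proof.
move=> [[_ t_gt0 _] [S_l _ _] [eq_x eq_y eq_a]].
move=> [_ [S_l' _ _] [eq_x' eq_y' eq_a']].
have eq_l : l = l' by nia.
apply: val_inj; move: eq_x eq_y eq_a eq_x' eq_y' eq_a'.
rewrite /odd_leg /even_leg /hypotenuse -eq_l.
by case: (val P) (val P') => [[x y] a] [[x' y'] a'] /= -> -> -> -> -> ->.
Qed.

Theorem theorem1p3 :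
  StrictOrder prec /\
  (forall P P' : PPT, prec P P' \/ P = P' \/ prec P' P).
Proof.
split.
  split.
    move=> P [S [t [l [S' [t' [l' [par par' lt_par]]]]]]].
    by have [eq_S eq_t] := parameters_unique par par'; lia.
  move=> P Q R [S1 [t1 [l1 [S2 [t2 [l2 [par1 par2 lt12]]]]]]].
  move=> [S3 [t3 [l3 [S4 [t4 [l4 [par3 par4 lt34]]]]]]].
  (* The two hypotheses may carry different parameters for the middle triple [Q]; uniqueness lets
     the comparisons chain. *)
  have [eq_S eq_t] := parameters_unique par2 par3.
  by exists S1, t1, l1, S4, t4, l4; split=> //; lia.
move=> P P'.
have [S [t [l par]]] := parameters_exist P.
have [S' [t' [l' par']]] := parameters_exist P'.
have [eq_St|[lt_St|gt_St]] : (S = S' /\ t = t') \/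
    (S < S' \/ (S = S' /\ t < t')) \/ (S' < S \/ (S' = S /\ t' < t)) by lia.
- right; left; case: eq_St => eq_S eq_t.
  by rewrite -eq_S -eq_t in par'; apply: parameters_inj par par'.
- by left; exists S, t, l, S', t', l'.
- by right; right; exists S', t', l', S, t, l.
Qed.
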